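(* In any triangle $ABC$ with side lengths $a, b, c$, area $S$, circumradius $R$ and inradius $r$, the following inequality holds: $$a^{2}+b^{2}+c^{2}\geq 2S\sqrt{3}+2r(4R+r)+(a-b)^{2}+(b-c)^{2}+(c-a)^{2}.$$
   Context: Triangles are nondegenerate Euclidean triangles. *)

(* Defs.v *)
From Stdlib Require Export Reals.
Open Scope R_scope.

Definition point : Type := (R * R)%type.

Definition distance (P Q : point) : R :=
  dist_euc (fst P) (snd P) (fst Q) (snd Q).

Definition line_point (P Q : point) (t : R) : point :=
  ((1 - t) * fst P + t * fst Q, (1 - t) * snd P + t * snd Q).

Definition on_line (P Q X : point) : Prop :=
  exists t : R, X = line_point P Q t.

Definition on_segment (P Q X : point) : Prop :=
  exists t : R, 0 <= t <= 1 /\ X = line_point P Q t.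

Definition nondegenerate (A B C : point) : Prop :=
  A <> B /\ ~ on_line A B C.

(* Half the absolute value of the determinant of (B - A, C - A). *)
Definition area (A B C : point) : R :=
  Rabs ((fst B - fst A) * (snd C - snd A)
        - (snd B - snd A) * (fst C - fst A)) / 2.

Definition is_circumradius (A B C : point) (rho : R) : Prop :=
  exists O : point,
    distance O A = rho /\ distance O B = rho /\ distance O C = rho.

(* The circle of center O and radius rho meets the whole line PQ in exactly
   one point, and this point lies on the side [P, Q]. *)
Definition tangent_to_side (O : point) (rho : R) (P Q : point) : Prop :=
  exists T : point,
    on_segment P Q T /\
    forall X : point, on_line P Q X -> (distance O X = rho <-> X = T).

(* Requiring the points of contact to lie on the sides themselves, and not
   only on their extensions, excludes the three excircles. *)
Definition is_inradius (A B C : point) (rho : R) : Prop :=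
  exists I : point,
    tangent_to_side I rho A B /\
    tangent_to_side I rho B C /\
    tangent_to_side I rho C A.

(* Main.v *)
Require Import Defs.
From Stdlib Require Import Reals.
From Stdlib Require Import Psatz.
Open Scope R_scope.

(** Let x, y, z be the tangent lengths from A, B, C to the incircle, so that
    a = y + z, b = z + x, c = x + y, and let s = x + y + z.  Then S^2 = s xyz,
    r s = S and 4 Rc S = abc give r (4 Rc + r) = xy + yz + zx, while
    a^2 + b^2 + c^2 - (a-b)^2 - (b-c)^2 - (c-a)^2 = 4 (xy + yz + zx).  The
    inequality becomes xy + yz + zx >= sqrt 3 * S, that is
    (xy + yz + zx)^2 >= 3 (xy yz + yz zx + zx xy). *)

(** Twice the signed area of the triangle: without the absolute value of [area], the identities
    below stay polynomial. *)
Definition cross (A B C : point) : R :=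
  (fst B - fst A) * (snd C - snd A) - (snd B - snd A) * (fst C - fst A).

Definition dot (A B C : point) : R :=
  (fst B - fst A) * (fst C - fst A) + (snd B - snd A) * (snd C - snd A).

Lemma distance_nonneg (P Q : point) : 0 <= distance P Q.
Proof. apply sqrt_pos. Qed.

Lemma distance_sqr (P Q : point) :
  distance P Q ^ 2 = (fst P - fst Q) ^ 2 + (snd P - snd Q) ^ 2.
Proof.
  unfold distance, dist_euc.
  rewrite pow2_sqrt by (apply Rplus_le_le_0_compat; apply Rle_0_sqr).
  unfold Rsqr; ring.
Qed.

Lemma sqr_inj_nonneg (x y : R) : 0 <= x -> 0 <= y -> x ^ 2 = y ^ 2 -> x = y.
Proof. intros; apply Rsqr_inj; trivial; unfold Rsqr; lra. Qed.

Lemma sqr_le_inv (x y : R) : 0 <= y -> x ^ 2 <= y ^ 2 -> x <= y.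
Proof. intros; apply Rsqr_incr_0_var; trivial; unfold Rsqr; lra. Qed.

Lemma sum_sqr_eq_0 (x y : R) : x ^ 2 + y ^ 2 = 0 -> x = 0 /\ y = 0.
Proof. intro H; apply Rplus_sqr_eq_0; unfold Rsqr; lra. Qed.

Lemma nondegenerate_cross (A B C : point) :
  nondegenerate A B C -> cross A B C <> 0.
Proof.
  intros [AB nAB] D0; apply nAB.
  destruct A as [a1 a2], B as [b1 b2], C as [c1 c2].
  unfold cross in D0; cbn in D0.
  assert (n0 : (b1 - a1) ^ 2 + (b2 - a2) ^ 2 <> 0).
  { intro H; apply sum_sqr_eq_0 in H; apply AB; f_equal; lra. }
  (* The parameter of the foot of the perpendicular from [C] to [AB]. The foot differs from [C] by a
     vector proportional to [cross A B C], hence equals [C]. *)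
  exists (((b1 - a1) * (c1 - a1) + (b2 - a2) * (c2 - a2))
          / ((b1 - a1) ^ 2 + (b2 - a2) ^ 2)).
  unfold line_point; cbn [fst snd].
  f_equal; apply (Rmult_eq_reg_r ((b1 - a1) ^ 2 + (b2 - a2) ^ 2)); trivial;
    field_simplify; trivial.
  - transitivity (c1 * ((b1 - a1) ^ 2 + (b2 - a2) ^ 2)
      + (b2 - a2) * ((b1 - a1) * (c2 - a2) - (b2 - a2) * (c1 - a1)));
      [rewrite D0 |]; ring.
  - transitivity (c2 * ((b1 - a1) ^ 2 + (b2 - a2) ^ 2)
      - (b1 - a1) * ((b1 - a1) * (c2 - a2) - (b2 - a2) * (c1 - a1)));
      [rewrite D0 |]; ring.
Qed.

Lemma cross_rotate (A B C : point) : cross B C A = cross A B C.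
Proof. unfold cross; ring. Qed.

Lemma cross_distance_pos (A B C : point) :
  cross A B C <> 0 -> 0 < distance A B.
Proof.
  intro D0; pose proof (distance_nonneg A B) as [H | H]; trivial.
  exfalso; apply D0.
  pose proof (distance_sqr A B) as E.
  rewrite <- H, pow_i in E by auto with arith.
  destruct (sum_sqr_eq_0 _ _ (eq_sym E)).
  unfold cross; replace (fst B) with (fst A) by lra;
    replace (snd B) with (snd A) by lra; ring.
Qed.

(** The law of cosines at [A]. *)
Lemma dot_distance (A B C : point) :
  2 * dot A B C = distance A B ^ 2 + distance C A ^ 2 - distance B C ^ 2.
Proof. rewrite !distance_sqr; unfold dot; ring. Qed.

(** Heron's formula, from Lagrange's identity [cross ^ 2 + dot ^ 2 = AB ^ 2 * CA ^ 2] and the law of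
    cosines. *)
Lemma cross_heron (A B C : point) (x y z : R) :
  distance B C = y + z -> distance C A = z + x -> distance A B = x + y ->
  cross A B C ^ 2 = 4 * ((x + y + z) * (x * y * z)).
Proof.
  intros Ha Hb Hc.
  assert (E : 4 * cross A B C ^ 2 = 4 * (distance A B ^ 2 * distance C A ^ 2)
                                - (2 * dot A B C) ^ 2).
  { rewrite !distance_sqr; unfold cross, dot; ring. }
  rewrite dot_distance, Ha, Hb, Hc in E; lra.
Qed.

(* The left side is the squared norm of (u.w) v - (v.w) u, which is w rotated
   by a right angle and scaled by [cross A B C]; here u = B - A, v = C - A and
   w = P - A. *)
Lemma dot_cross_norm (A B C P : point) :
  dot A B P ^ 2 * distance C A ^ 2 + dot A C P ^ 2 * distance A B ^ 2
    - 2 * dot A B P * dot A C P * dot A B C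
  = cross A B C ^ 2 * distance P A ^ 2.
Proof. rewrite !distance_sqr; unfold cross, dot; ring. Qed.

(** The square of [abc = 4 S R]. The circumcenter projects to the midpoints of [AB] and [CA], which
    fixes both dot products in [dot_cross_norm]. *)
Lemma circumradius_sqr (A B C : point) (rho : R) :
  is_circumradius A B C rho ->
  4 * cross A B C ^ 2 * rho ^ 2
  = (distance B C * distance C A * distance A B) ^ 2.
Proof.
  intros [O (OA & OB & OC)].
  pose proof (dot_cross_norm A B C O) as E.
  pose proof (dot_distance A B C) as H.
  assert (HB : 2 * dot A B O = distance A B ^ 2).
  { rewrite dot_distance, OA.
    replace (distance B O) with rho; [ring |].
    rewrite <- OB; apply distance_symm. }
  assert (HC : 2 * dot A C O = distance C A ^ 2).
  { rewrite dot_distance, OA.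
    replace (distance C O) with rho.
    - replace (distance A C) with (distance C A) by apply distance_symm; ring.
    - rewrite <- OC; apply distance_symm. }
  rewrite OA in E.
  replace (dot A B C) with
    ((distance A B ^ 2 + distance C A ^ 2 - distance B C ^ 2) / 2) in E by lra.
  replace (dot A B O) with (distance A B ^ 2 / 2) in E by lra.
  replace (dot A C O) with (distance C A ^ 2 / 2) in E by lra.
  transitivity (4 * (cross A B C ^ 2 * rho ^ 2)); [ring |].
  rewrite <- E; field.
Qed.

(** Uniqueness of the contact point makes it the foot of the perpendicular from [O]; the last two
    equations are then Pythagoras. *)
Lemma tangent_to_side_foot (O P Q : point) (rho : R) :
  0 < distance P Q -> tangent_to_side O rho P Q ->
  0 <= rho /\
  exists t : R, 0 <= t <= 1
    /\ dot P Q O = t * distance P Q ^ 2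
    /\ distance O P ^ 2 = rho ^ 2 + (t * distance P Q) ^ 2
    /\ distance O Q ^ 2 = rho ^ 2 + ((1 - t) * distance P Q) ^ 2.
Proof.
  intros d0 [T [[t [t01 ET]] uniq]].
  assert (OT : distance O T = rho) by (apply uniq; [exists t |]; trivial).
  split; [rewrite <- OT; apply distance_nonneg |].
  exists t; split; trivial.
  assert (n0 : 0 < distance P Q ^ 2) by nra.
  assert (foot : dot P Q O = t * distance P Q ^ 2).
  { (* The reflection of [T] in the foot of the perpendicular from [O] is on
       the line at the same distance from [O], hence it is [T]. *)
    set (t' := 2 * (dot P Q O / distance P Q ^ 2) - t).
    assert (EX : line_point P Q t' = T).
    { apply uniq; [exists t'; trivial |].
      rewrite <- OT; apply sqr_inj_nonneg; try apply distance_nonneg.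
      assert (E : forall u, distance O (line_point P Q u) ^ 2
        = distance O P ^ 2 - 2 * u * dot P Q O + u ^ 2 * distance P Q ^ 2).
      { intro u; rewrite !distance_sqr; unfold dot, line_point; cbn; ring. }
      rewrite ET, !E; unfold t'; field; lra. }
    assert (Et : t' = t).
    { assert (E : (t' - t) * distance P Q ^ 2 = 0).
      { transitivity
          ((fst (line_point P Q t') - fst (line_point P Q t)) * (fst Q - fst P)
           + (snd (line_point P Q t') - snd (line_point P Q t))
             * (snd Q - snd P)).
        - rewrite distance_sqr; unfold line_point; cbn; ring.
        - rewrite EX, ET; ring. }
      nra. }
    unfold t' in Et.
    replace (dot P Q O) with (dot P Q O / distance P Q ^ 2 * distance P Q ^ 2)
      by (field; lra).
    nra. }
  assert (EP : distance O P ^ 2 = rho ^ 2 + (t * distance P Q) ^ 2).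
  { assert (E : rho ^ 2
        = distance O P ^ 2 - 2 * t * dot P Q O + t ^ 2 * distance P Q ^ 2).
    { rewrite <- OT, ET, !distance_sqr; unfold dot, line_point; cbn; ring. }
    rewrite foot in E; lra. }
  repeat split; trivial.
  assert (E : distance O Q ^ 2
      = distance O P ^ 2 - 2 * dot P Q O + distance P Q ^ 2).
  { rewrite !distance_sqr; unfold dot; ring. }
  rewrite foot, EP in E; lra.
Qed.

Lemma incircle_tangent_lengths (A B C : point) (r : R) :
  nondegenerate A B C -> is_inradius A B C r ->
  0 <= r /\
  exists x y z : R, 0 < x /\ 0 < y /\ 0 < z
    /\ distance B C = y + z /\ distance C A = z + x /\ distance A B = x + y
    /\ (x + y + z) * r ^ 2 = x * y * z.
Proof.
  intros nd [I (TAB & TBC & TCA)].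
  pose proof (nondegenerate_cross _ _ _ nd) as D0.
  assert (c0 : 0 < distance A B) by now apply (cross_distance_pos A B C).
  assert (a0 : 0 < distance B C).
  { apply (cross_distance_pos B C A); now rewrite cross_rotate. }
  assert (b0 : 0 < distance C A).
  { apply (cross_distance_pos C A B); now do 2 rewrite cross_rotate. }
  destruct (tangent_to_side_foot _ _ _ _ c0 TAB)
    as [r0 [t (t01 & ft & tA & tB)]].
  destruct (tangent_to_side_foot _ _ _ _ a0 TBC)
    as [_ [u (u01 & _ & uB & uC)]].
  destruct (tangent_to_side_foot _ _ _ _ b0 TCA)
    as [_ [v (v01 & fv & vC & vA)]].
  (* The two tangents from a vertex have equal squares by Pythagoras; the contact points lie on the
     sides, so the lengths are nonnegative and agree. *)
  assert (EA : t * distance A B = (1 - v) * distance C A)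
    by (apply sqr_inj_nonneg;
        [apply Rmult_le_pos | apply Rmult_le_pos |]; lra).
  assert (EB : u * distance B C = (1 - t) * distance A B)
    by (apply sqr_inj_nonneg;
        [apply Rmult_le_pos | apply Rmult_le_pos |]; lra).
  assert (EC : v * distance C A = (1 - u) * distance B C)
    by (apply sqr_inj_nonneg;
        [apply Rmult_le_pos | apply Rmult_le_pos |]; lra).
  split; trivial.
  set (x := t * distance A B) in *.
  set (y := u * distance B C) in *.
  set (z := v * distance C A) in *.
  assert (Ha : distance B C = y + z) by (rewrite EC; unfold y; ring).
  assert (Hb : distance C A = z + x) by (rewrite EA; unfold z; ring).
  assert (Hc : distance A B = x + y) by (rewrite EB; unfold x; ring).
  assert (x0 : 0 <= x) by (apply Rmult_le_pos; lra).
  assert (y0 : 0 <= y) by (apply Rmult_le_pos; lra).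
  assert (z0 : 0 <= z) by (apply Rmult_le_pos; lra).
  pose proof (cross_heron A B C x y z Ha Hb Hc) as heron.
  (* A zero tangent length would make the area vanish by Heron. *)
  assert (xyz : x <> 0 /\ y <> 0 /\ z <> 0).
  { assert (D2 : cross A B C ^ 2 <> 0) by now apply pow_nonzero.
    repeat split; intro E; apply D2; rewrite heron, E; ring. }
  assert (x1 : 0 < x) by lra; assert (y1 : 0 < y) by lra;
    assert (z1 : 0 < z) by lra.
  exists x, y, z; repeat split; trivial.
  assert (dB : dot A B I = x * (x + y)).
  { rewrite ft, <- Hc; unfold x; ring. }
  assert (dC : dot A C I = x * (z + x)).
  { assert (E : dot A C I = distance C A ^ 2 - dot C A I).
    { rewrite distance_sqr; unfold dot; ring. }
    rewrite E, fv, <- Hb, EA; ring. }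
  pose proof (dot_cross_norm A B C I) as E.
  pose proof (dot_distance A B C) as H.
  rewrite Ha, Hb, Hc in H.
  rewrite heron, tA, dB, dC, Hb, Hc in E.
  replace (dot A B C)
    with (((x + y) ^ 2 + (z + x) ^ 2 - (y + z) ^ 2) / 2) in E by lra.
  (* With [s = x + y + z], cancelling [4xyz] in [E] leaves [x (x + y) (z + x) = s (r ^ 2 + x ^ 2)],
     whose left side is [s x ^ 2 + xyz]. *)
  apply (Rmult_eq_reg_l (4 * (x * y * z))); [| nra].
  lra.
Qed.

(** The difference of the two sides is half the sum of the squared differences of [xy], [yz],
    [zx]. *)
Lemma newton_three_variables (x y z : R) :
  3 * ((x + y + z) * (x * y * z)) <= (x * y + y * z + z * x) ^ 2.
Proof.
  pose proof (pow2_ge_0 (x * y - y * z)); pose proof (pow2_ge_0 (y * z - z * x));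
    pose proof (pow2_ge_0 (z * x - x * y)); lra.
Qed.

Theorem theorem2p1 (A B C : point) (a b c S Rc r : R)
  (hABC : nondegenerate A B C)
  (ha : a = distance B C) (hb : b = distance C A) (hc : c = distance A B)
  (hS : S = area A B C)
  (hRc : is_circumradius A B C Rc)
  (hr : is_inradius A B C r) :
  a ^ 2 + b ^ 2 + c ^ 2 >=
    2 * S * sqrt 3 + 2 * r * (4 * Rc + r)
    + (a - b) ^ 2 + (b - c) ^ 2 + (c - a) ^ 2.
Proof.
  destruct (incircle_tangent_lengths A B C r hABC hr)
    as [r0 (x & y & z & x0 & y0 & z0 & Ha & Hb & Hc & Er)].
  pose proof (cross_heron A B C x y z Ha Hb Hc) as heron.
  pose proof (circumradius_sqr A B C Rc hRc) as ER.
  assert (R0 : 0 <= Rc).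
  { destruct hRc as [O [OA _]]; rewrite <- OA; apply distance_nonneg. }
  assert (S0 : 0 <= S).
  { rewrite hS; unfold area; pose proof (Rabs_pos (cross A B C)) as H.
    unfold cross in H; lra. }
  assert (ES : 4 * S ^ 2 = cross A B C ^ 2).
  { rewrite hS, <- (pow2_abs (cross A B C)); unfold area, cross; field. }
  rewrite Ha, Hb, Hc in ER.
  rewrite Ha in ha; rewrite Hb in hb; rewrite Hc in hc; subst a b c.
  assert (s0 : 0 < x + y + z) by lra.
  assert (xy0 : 0 < x * y) by nra.
  assert (yz0 : 0 < y * z) by nra.
  assert (zx0 : 0 < z * x) by nra.
  assert (rs : (x + y + z) * r = S).
  { apply sqr_inj_nonneg; [nra | trivial |].
    transitivity ((x + y + z) * ((x + y + z) * r ^ 2)); [ring |].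
    rewrite Er; lra. }
  assert (abc : 4 * S * Rc = (y + z) * (z + x) * (x + y)).
  { apply sqr_inj_nonneg; [nra | |].
    - repeat apply Rmult_le_pos; lra.
    - rewrite <- ER, <- ES; ring. }
  (* Multiplied by [x + y + z], the left side becomes [(y + z) (z + x) (x + y) + xyz], which factors
     as [(x + y + z) (xy + yz + zx)]. *)
  assert (K : r * (4 * Rc + r) = x * y + y * z + z * x).
  { apply (Rmult_eq_reg_l (x + y + z)); [| lra].
    transitivity (4 * ((x + y + z) * r) * Rc + (x + y + z) * r ^ 2); [ring |].
    rewrite rs, abc, Er; ring. }
  assert (main : S * sqrt 3 <= x * y + y * z + z * x).
  { apply sqr_le_inv; [lra |].
    rewrite Rpow_mult_distr, pow2_sqrt by lra.
    pose proof (newton_three_variables x y z); lra. }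
  lra.
Qed.
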